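(* Let $(X,\mathsf d,\mathfrak m)$ be a metric measure space with gauge function $\mathsf G$, satisfying the $\mathsf{CD}(\beta,n)$ condition, with $n\in[1,+\infty)$ and $\beta$ a distortion coefficient. Let $A_0,A_1\subset X$ be Borel sets with $\mathfrak m(A_0),\mathfrak m(A_1)>0$ and $\mathfrak m(A_0\cap A_1)=0$. Then $$\bar{\mathfrak m}(A_t)^{1/n}\ge\beta_{1-t}(A_1,A_0)^{1/n}\cdot\mathfrak m(A_0)^{1/n}+\beta_t(A_0,A_1)^{1/n}\cdot\mathfrak m(A_1)^{1/n},\qquad\forall\,t\in(0,1),$$ where $\bar{\mathfrak m}$ is the completion of $\mathfrak m$, $A_t$ is the set of $t$-intermediate points between $A_0$ and $A_1$, and with the convention that $0\cdot\infty=0$.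
   Context: A metric measure space is a complete separable metric space $(X,\mathsf d)$ with a non-negative Borel measure $\mathfrak m$ finite on bounded sets; a gauge function is a Borel map $\mathsf G:X\times X\to[0,+\infty]$. $\mathrm{Geo}(X)$: curves $\gamma:[0,1]\to X$ with $\mathsf d(\gamma_s,\gamma_t)=|s-t|\mathsf d(\gamma_0,\gamma_1)$; $\mathrm e_t(\gamma)=\gamma_t$. **Distortion coefficient.** Given $\mathsf s:[0,\infty)\to\mathbb R$ continuous with $\mathsf s(\theta)=c\theta^N+o(\theta^N)$ as $\theta\to0$ for some $c>0$, $N\in[1,\infty)$, let $\mathcal D=\inf\{\theta>0:\mathsf s(\theta)=0\}$. For $t\in[0,1]$, $\theta\in[0,+\infty]$: $\beta_t(0)=t^N$; $\beta_t(\theta)=\mathsf s(t\theta)/\mathsf s(\theta)$ if $0<\theta<\mathcal D$; $\beta_t(\theta)=\liminf_{\phi\to\mathcal D^-}\mathsf s(t\phi)/\mathsf s(\phi)$ if $\theta\ge\mathcal D$. **$\mathsf{CD}(\beta,n)$.** $W_2$ is the quadratic Wasserstein distance; $\mathrm{OptGeo}(\mu_0,\mu_1)$ is the set of $\nu\in\mathcal P(\mathrm{Geo}(X))$ such that $(\mathrm e_0,\mathrm e_1)_\sharp\nu$ is an optimal coupling for the cost $\mathsf d^2$. $\mathrm{Ent}(\mu|\mathfrak m)=\int\rho\log\rho\,d\mathfrak m$ if $\mu=\rho\mathfrak m$ has finite second moment and $\rho\log\rho\in L^1$, $+\infty$ otherwise; $\mathrm U_n(\mu|\mathfrak m)=\exp(-\mathrm{Ent}(\mu|\mathfrak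 m)/n)$ (equal to $0$ if $\mathrm{Ent}=+\infty$). $\mathcal P_{bs}$: probability measures with bounded support in $\mathrm{supp}\,\mathfrak m$; $\mathcal P_{bs}^*$: those with finite entropy. The condition: for all $\mu_0\in\mathcal P_{bs}$, $\mu_1\in\mathcal P_{bs}^*$ with disjoint supports there is a $W_2$-geodesic $\mu_t=(\mathrm e_t)_\sharp\nu$, $\nu\in\mathrm{OptGeo}(\mu_0,\mu_1)$, such that for all $t\in(0,1)$ $$\mathrm U_n(\mu_t|\mathfrak m)\ge e^{\frac1n\int\log\beta_{1-t}(\mathsf G(\gamma_1,\gamma_0))\,\nu(d\gamma)}\mathrm U_n(\mu_0|\mathfrak m)+e^{\frac1n\int\log\beta_t(\mathsf G(\gamma_0,\gamma_1))\,\nu(d\gamma)}\mathrm U_n(\mu_1|\mathfrak m)\qquad(\infty\cdot0=0).$$ **Sets.** $A_t=\{\gamma_t:\gamma\in\mathrm{Geo}(X),\gamma_0\in A_0,\gamma_1\in A_1\}$ (a Suslin set). For non-empty Borel sets $A_0,A_1$, $\beta_t(A_0,A_1)=\sup_{\tilde A_i\subseteq A_i}\inf\{\beta_t(\mathsf G(x_0,x_1)):x_i\in\tilde A_i\cap\mathrm{supp}\,\mathfrak m,\ i=0,1\}$, the supremum over all full-$\mathfrak m$-measure non-empty subsets $\tilde A_i\subseteq A_i$, $i=0,1$. *)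

(* Defs.v *)
From HB Require Import structures.
From mathcomp Require Import all_boot all_order all_algebra.
From mathcomp Require Import all_classical all_reals all_analysis.
From mathcomp Require Import measurable_realfun.

Set Implicit Arguments.
Unset Strict Implicit.
Unset Printing Implicit Defensive.

Import Order.TTheory GRing.Theory Num.Theory.
Import numFieldNormedType.Exports.

Local Open Scope classical_set_scope.
Local Open Scope ring_scope.

HB.instance Definition _ (T U : ptopologicalType) := Pointed.on (T * U)%type.

(* Completeness and measurability come with a base point in the library; this
   only excludes the empty space. *)
#[short(type="completeMetricType")]
HB.structure Definition CompleteMetric (R : realType) :=
  {X of Metric R X & Complete X}.

Definition separable (T : topologicalType) : Prop :=
  exists2 D : set T, countable D & dense D.

Definition metric_bounded (R : realType) (X : metricType R) (A : set X) : Prop :=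
  exists (x : X) (r : R), forall y, A y -> mdist x y <= r.

(* On a product, this is the Borel sigma-algebra of the product topology. *)
Definition borel (T : ptopologicalType) : measurableType _ :=
  g_sigma_algebraType (@open T).

Section geodesics.
Variables (R : realType) (X : completeMetricType R).

Definition geodesic : set {uniform {i01 R} -> X} :=
  [set g | forall s t : {i01 R}, mdist (g s) (g t) =
     `|s%:num - t%:num| * mdist (g 0%:i01) (g 1%:i01)].

Definition Geo : Type := set_type geodesic.

(* The topology of uniform convergence, which underlies [borel Geo]. *)
HB.instance Definition _ := Uniform.copy Geo (set_type geodesic).

Lemma geodesic_cst : geodesic (fun=> point).
Proof. by move=> s t; rewrite !mdistxx mulr0. Qed.

HB.instance Definition _ := isPointed.Build Geo (SigSub (mem_set geodesic_cst)).

Definition geo_eval (t : {i01 R}) (g : Geo) : X := set_val g t.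
Definition source : Geo -> X := geo_eval 0%:i01.
Definition target : Geo -> X := geo_eval 1%:i01.

Definition intermediate (A0 A1 : set X) (t : {i01 R}) : set X :=
  [set geo_eval t g | g in [set g | A0 (source g) /\ A1 (target g)]].

End geodesics.
Arguments geo_eval {R X}.
Arguments source {R X}.
Arguments target {R X}.

Section distortion.
Variables (R : realType) (s : R -> R) (N : R).
Local Open Scope ereal_scope.

(* [R^o] is needed only for the Landau notation to see a normed module. *)
Definition distortion_datum : Prop :=
  [/\ (1 <= N)%R, {within `[0%R, +oo[, continuous s} &
      exists2 c : R, (0 < c)%R &
        (s : R -> R^o) = (fun th => c * th `^ N : R^o)%R
                          +o_ (0%R^'+) (fun th => th `^ N : R^o)%R].

Definition first_zero : \bar R :=
  ereal_inf [set th%:E | th in [set th : R | (0 < th)%R /\ s th = 0%R]].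

Definition distortion (t : R) (th : \bar R) : \bar R :=
  if th == 0 then (t `^ N)%:E
  else if th < first_zero then (s (t * fine th) / s (fine th))%:E
  else limf_einf (fun phi : \bar R => (s (t * fine phi) / s (fine phi))%:E)
         (within [set phi | phi < first_zero] (nbhs first_zero)).

End distortion.

Section optimal_transport.
Variables (R : realType) (X : completeMetricType R).
Local Open Scope ereal_scope.

Definition coupling (mu nu : set (borel X) -> \bar R)
    (pi : set (borel (X * X)%type) -> \bar R) : Prop :=
  forall A : set (borel X), measurable A ->
    pi (fst @^-1` A) = mu A /\ pi (snd @^-1` A) = nu A.

Definition transport_cost (pi : set (borel (X * X)%type) -> \bar R) : \bar R :=
  \int[pi]_p (mdist p.1 p.2 ^+ 2)%:E.

Definition W2 (mu nu : set (borel X) -> \bar R) : \bar R :=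
  (ereal_inf [set transport_cost pi | pi in
    [set pi : probability (borel (X * X)%type) R | coupling mu nu pi]])
  `^ (2^-1)%R.

Definition optimal_coupling (mu nu : set (borel X) -> \bar R)
    (pi : set (borel (X * X)%type) -> \bar R) : Prop :=
  coupling mu nu pi /\
  forall pi' : probability (borel (X * X)%type) R,
    coupling mu nu pi' -> transport_cost pi <= transport_cost pi'.

Definition push_geo (nu : set (borel (Geo X)) -> \bar R) (t : {i01 R}) :
    set (borel X) -> \bar R :=
  pushforward nu (geo_eval t : borel (Geo X) -> borel X).

Definition push_ends (nu : set (borel (Geo X)) -> \bar R) :
    set (borel (X * X)%type) -> \bar R :=
  pushforward nu ((fun g => (source g, target g)) :
    borel (Geo X) -> borel (X * X)%type).

Definition OptGeo (mu0 mu1 : set (borel X) -> \bar R) :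
    set (probability (borel (Geo X)) R) :=
  [set nu | optimal_coupling mu0 mu1 (push_ends nu)].

Definition W2_geodesic (mu : {i01 R} -> set (borel X) -> \bar R) : Prop :=
  forall s t : {i01 R},
    W2 (mu s) (mu t) = `|s%:num - t%:num|%:E * W2 (mu 0%:i01%R) (mu 1%:i01%R).

End optimal_transport.

Section metric_measure.
Variables (R : realType) (X : completeMetricType R).
Variable m : {measure set (borel X) -> \bar R}.
Local Open Scope ereal_scope.

Definition metric_measure_space : Prop :=
  separable X /\
  forall A : set (borel X), measurable A -> metric_bounded A -> m A < +oo.

Definition gauge_function (G : X -> X -> \bar R) : Prop :=
  (forall x y, 0 <= G x y) /\
  measurable_fun [set: borel (X * X)%type] (fun p => G p.1 p.2).

Definition msupport (mu : set (borel X) -> \bar R) : set X :=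
  [set x | forall U : set X, open U -> U x -> 0 < mu U].

(* [ln 0 = 0], hence [rho * ln rho = 0] where [rho] vanishes. *)
Definition entropy_density (mu : set (borel X) -> \bar R) (rho : borel X -> R) :
    Prop :=
  [/\ measurable_fun setT rho, forall x, (0 <= rho x)%R,
      forall A : set (borel X), measurable A -> mu A = \int[m]_(x in A) (rho x)%:E &
      m.-integrable setT (fun x => (rho x * ln (rho x))%:E)].

Definition finite_second_moment (mu : set (borel X) -> \bar R) : Prop :=
  exists x0 : X, \int[mu]_x (mdist x0 x ^+ 2)%:E < +oo.

(* Two densities of [mu] agree [m]-almost everywhere, so the value does not
   depend on the one that is picked. *)
Definition Ent (mu : set (borel X) -> \bar R) : \bar R :=
  match pselect (exists rho, finite_second_moment mu /\ entropy_density mu rho)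
  with
  | left h => \int[m]_x (projT1 (cid h) x * ln (projT1 (cid h) x))%:E
  | right _ => +oo
  end.

Definition Un (n : R) (mu : set (borel X) -> \bar R) : \bar R :=
  expeR (- ((n^-1)%:E * Ent mu)).

Definition Pbs (mu : probability (borel X) R) : Prop :=
  metric_bounded (msupport mu) /\ msupport mu `<=` msupport m.

Definition Pbs_star (mu : probability (borel X) R) : Prop :=
  Pbs mu /\ Ent mu < +oo.

(* [lne 0 = -oo], [expeR -oo = 0] and [0 * +oo = 0]; an integral whose positive
   and negative parts are both infinite has value [-oo]. *)
Definition CD (G : X -> X -> \bar R) (beta : R -> \bar R -> \bar R) (n : R) :
    Prop :=
  forall mu0 mu1 : probability (borel X) R,
    Pbs mu0 -> Pbs_star mu1 -> msupport mu0 `&` msupport mu1 = set0 ->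
  exists nu : probability (borel (Geo X)) R,
    [/\ OptGeo mu0 mu1 nu, W2_geodesic (push_geo nu) &
    forall t : {i01 R}, (0 < t%:num < 1)%R ->
      expeR ((n^-1)%:E * \int[nu]_g
          lne (beta (1 - t%:num)%R (G (target g) (source g)))) * Un n mu0
      + expeR ((n^-1)%:E * \int[nu]_g
          lne (beta t%:num (G (source g) (target g)))) * Un n mu1
      <= Un n (push_geo nu t)].

Definition full_subset (A B : set X) : Prop :=
  [/\ B `<=` A, B !=set0 & m.-negligible (A `\` B : set (borel X))].

Definition set_distortion (G : X -> X -> \bar R) (beta : \bar R -> \bar R)
    (A0 A1 : set X) : \bar R :=
  ereal_sup [set b | exists B0 B1, [/\ full_subset A0 B0, full_subset A1 B1 &
    b = ereal_inf [set beta (G x.1 x.2) | x in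
          (B0 `&` msupport m) `*` (B1 `&` msupport m)]]].

(* The completion as the restriction of the outer measure generated by [m] to
   its Caratheodory-measurable sets; for sigma-finite [m] these are the sets of
   the completed sigma-algebra. *)
Definition completion : set X -> \bar R := @completed_measure_extension _ _ _ m.

End metric_measure.

(* Main.v *)
(* The completed measure of the set of intermediate points is the infimum of
   [m B] over measurable [B] containing it, so no Suslin set theory is needed.
   By inner regularity, [A0] and [A1] may be replaced by disjoint closed bounded
   sets [F0] and [F1]. Apply CD to the normalized restrictions of [m] to them:
   [Un] of these is [m F0 `^ n^-1] and [m F1 `^ n^-1], the geodesics end almost
   surely in any prescribed full-measure subsets of [F0] and [F1] (which bounds
   the distortion terms below by infima), and the [t]-marginal is carried by
   [B], so that by Jensen its [Un] is at most [m B `^ n^-1]. *)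

Require Import Defs.
From HB Require Import structures.
From mathcomp Require Import all_boot all_order all_algebra.
From mathcomp Require Import all_classical all_reals all_analysis.
From mathcomp Require Import measurable_realfun lra.

Set Implicit Arguments.
Unset Strict Implicit.
Unset Printing Implicit Defensive.

Import Order.TTheory GRing.Theory Num.Theory.
Import numFieldNormedType.Exports.

Local Open Scope classical_set_scope.
Local Open Scope ring_scope.
Local Open Scope ereal_scope.

(** * Powers, exponentials and logarithms on the extended reals *)

Lemma le_poweR_inv (R : realType) (r : R) (x y : \bar R) :
  (0 < r)%R -> 0 <= x -> 0 <= y -> (x `^ r <= y) = (x <= y `^ r^-1).
Proof.
move=> r0 x0 y0; have r'0 : (r != 0)%R by rewrite gt_eqF.
have in0 (z : \bar R) : 0 <= z -> z \in `[0, +oo].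
  by move=> z0; rewrite in_itv/= z0 leey.
apply/idP/idP => h.
  rewrite -[x](poweRe1 x0) -(divff r'0) poweRrM.
  apply: gt0_ler_poweR h;
    [by rewrite invr_ge0 ltW|exact/in0/poweR_ge0|exact: in0].
rewrite -[y](poweRe1 y0) -(mulVf r'0) poweRrM.
by apply: gt0_ler_poweR h; [exact: ltW|exact: in0|exact/in0/poweR_ge0].
Qed.

(** Serves to remove a supremum from one factor of one summand: solved for [x], the hypothesis is an
    upper bound on [x] alone, which passes to the supremum. The values [k = 0], [C = +oo] and
    [k = +oo], where division fails, are treated apart. *)
Lemma poweR_ereal_sup_le (R : realType) (S : set \bar R) (r : R)
    (k e C : \bar R) :
  (0 < r)%R -> S !=set0 -> (forall x, S x -> 0 <= x) -> 0 <= k -> 0 <= e ->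
  (forall x, S x -> x `^ r * k + e <= C) ->
  ereal_sup S `^ r * k + e <= C.
Proof.
move=> r0 [x0 Sx0] S0 k0 e0 SC.
have sup0 : 0 <= ereal_sup S.
  by apply: le_trans (S0 _ Sx0) _; exact: ereal_sup_ubound.
have [k_0|k_neq0] := eqVneq k 0.
  by have := SC _ Sx0; rewrite k_0 !mule0.
have {k_neq0}k_gt0 : 0 < k by rewrite lt_neqAle eq_sym k_neq0.
have [->|C_neqy] := eqVneq C +oo; first exact: leey.
have eC : e <= C.
  by apply: le_trans (SC _ Sx0); rewrite leeDr// mule_ge0// poweR_ge0.
have Cfin : C \is a fin_num.
  by rewrite ge0_fin_numE ?(le_trans e0 eC)// ltey.
have efin : e \is a fin_num.
  by rewrite ge0_fin_numE// (le_lt_trans eC)// ltey.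
have {}SC x : S x -> x `^ r * k <= C - e by move=> /SC; rewrite leeBrDr.
rewrite -leeBrDr//.
have Ce0 : 0 <= C - e by rewrite sube_ge0// efin.
case: k k0 k_gt0 SC => [k||]// k0 k_gt0 SC; last first.
  (* For [k = +oo], finiteness of [C - e] forces every element of [S] to be 0, and 0 times infinity
     is 0. *)
  suff -> : ereal_sup S = 0 by rewrite poweR0r ?gt_eqF// mul0e.
  apply/eqP; rewrite eq_le sup0 andbT; apply: ge_ereal_sup => x Sx.
  have := SC _ Sx; rewrite leNgt; apply: contraNT; rewrite -ltNge => x_gt0.
  by rewrite gt0_muley ?poweR_gt0// ltey_eq fin_numB Cfin efin.
have k1 : (0 < k)%R by rewrite -lte_fin.
rewrite -lee_pdivlMr//.
have D0 : 0 <= (C - e) * k^-1%:E by rewrite mule_ge0// lee_fin invr_ge0 ltW.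
rewrite le_poweR_inv//; apply: ge_ereal_sup => x Sx.
by rewrite -(le_poweR_inv r0 (S0 _ Sx) D0) lee_pdivlMr// SC.
Qed.

Lemma expeR_lne_poweR (R : realType) (r : R) (b : \bar R) :
  (0 < r)%R -> 0 <= b -> expeR (r%:E * lne b) = b `^ r.
Proof.
move=> r0; case: b => [b||]//; last first.
  by move=> _ /=; rewrite gt_eqF// gt0_muley.
rewrite lee_fin le_eqVlt => /predU1P[<-|b0].
  by rewrite /= lexx powR0 ?gt_eqF// gt0_muleNy.
by rewrite lne_EFin//= /powR gt_eqF.
Qed.

(** Convexity of [x * ln x]: the left side is its tangent line at [a]. For positive [x] it comes
    down to [ln y <= y - 1] at [y = a / x]. *)
Lemma mul_ln_ge_tangent (R : realType) (a x : R) : (0 < a -> 0 <= x ->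
  x * (ln a + 1) - a <= x * ln x)%R.
Proof.
move=> a0; rewrite le_eqVlt => /predU1P[<-|x0].
  by rewrite !mul0r sub0r oppr_le0 ltW.
have : (ln (a / x) <= a / x - 1)%R.
  have := @le_ln1Dx R (a / x - 1); rewrite addrCA subrr addr0; apply.
  by rewrite ltrBrDl subrr divr_gt0.
rewrite ln_div ?posrE// => h.
have : (x * (ln a - ln x) <= x * (a / x - 1))%R by rewrite ler_pM2l.
by rewrite mulrBr mulrBr mulr1 mulrCA divff ?gt_eqF// mulr1; lra.
Qed.

(** * Lower bounds for integrals of possibly non-measurable functions *)

Section integral_bounds.
Context d (T : measurableType d) (R : realType).
Implicit Types f g : T -> \bar R.

(** The integral of a nonnegative function is a supremum over the simple functions below it, and
    enlarging the function only adds competitors. *)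
Lemma ge0_le_integral_nonmeasurable (m : {measure set T -> \bar R}) f g :
  (forall x, 0 <= f x) -> (forall x, f x <= g x) ->
  \int[m]_x f x <= \int[m]_x g x.
Proof.
move=> f0 fg; rewrite !ge0_integralTE//; last first.
  by move=> x; exact: le_trans (f0 x) (fg x).
apply: ereal_sup_le => _ [h hf <-]; exists h => // x.
exact: le_trans (hf x) (fg x).
Qed.

Lemma le_integral_nonmeasurable (m : {measure set T -> \bar R}) f g :
  (forall x, f x <= g x) -> \int[m]_x f x <= \int[m]_x g x.
Proof.
move=> fg; rewrite integralE [leRHS]integralE; apply: leeB.
  apply: ge0_le_integral_nonmeasurable => // x.
  by apply: (@funepos_le _ _ setT f g) => [y _|]; rewrite ?inE.
apply: ge0_le_integral_nonmeasurable => // x.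
by apply: (@funeneg_le _ _ setT f g) => [y _|]; rewrite ?inE.
Qed.

(* CD integrates the distortion without asserting its measurability, so the
   monotonicity lemmas of the library do not apply. *)
Lemma le_integral_probability (P : probability T R) f (E : set T) (c : \bar R) :
  measurable E -> P E = 1 -> (forall x, E x -> c <= f x) -> c <= \int[P]_x f x.
Proof.
(* [g] is a measurable minorant of [f] on the whole space and equals [c] almost surely. *)
move=> mE PE cf; pose g x := if x \in E then c else -oo.
have mg : measurable_fun setT g.
  apply: measurable_fun_ifT => //; apply: (measurable_fun_bool true).
  rewrite setTI (_ : _ @^-1` _ = E)//; apply/seteqP.
  by split=> x; [exact: set_mem|exact: mem_set].
have -> : c = \int[P]_x g x.
  rewrite -[LHS]mule1 -(probability_setT P) -(integral_cst P measurableT).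
  apply: ae_eq_integral => //; exists (~` E); split.
  - exact: measurableC.
  - by apply: eq_trans (probability_setC P mE) _; rewrite PE subee.
  - move=> x /= /not_implyP[_ h] Ex; apply: h.
    by rewrite /g mem_set.
apply: le_integral_nonmeasurable => x; rewrite /g.
by case: ifPn => [/set_mem/cf//|_]; rewrite leNye.
Qed.

(** Bounds the geometric-mean coefficients of CD from below by powers of an almost sure lower bound
    of the distortion. *)
Lemma poweR_le_expeR_integral_lne (P : probability T R) f (E : set T)
    (b : \bar R) (r : R) : (0 < r)%R -> 0 <= b -> measurable E -> P E = 1 ->
  (forall x, E x -> b <= f x) ->
  b `^ r <= expeR (r%:E * \int[P]_x lne (f x)).
Proof.
move=> r0 b0 mE PE bf; rewrite -expeR_lne_poweR// lee_expeR lee_pmul2l//.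
apply: (le_integral_probability mE PE) => x /bf bfx.
by rewrite lee_lne// in_itv/= leey andbT// (le_trans b0).
Qed.

End integral_bounds.

(** * Borel measurability, metric balls and evaluation of geodesics *)

Section borel_measurability.
Implicit Types T U : ptopologicalType.

Lemma open_borel T (A : set T) : open A -> measurable (A : set (borel T)).
Proof. by move=> oA; exact: sub_sigma_algebra. Qed.

Lemma closed_borel T (A : set T) : closed A -> measurable (A : set (borel T)).
Proof.
move=> cA; rewrite -[A]setCK; apply: (@measurableC _ (borel T)).
by apply: open_borel; rewrite openC.
Qed.

Lemma continuous_borel T U (f : T -> U) :
  continuous f -> measurable_fun setT (f : borel T -> borel U).
Proof.
move=> /continuousP cf.
apply: (@measurability _ _ (borel T) (borel U) setT f (@open U) erefl).
by move=> _ [B oB <-]; rewrite setTI; apply: open_borel; exact: cf.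
Qed.

Lemma continuous_borel_real (R : realType) T (f : T -> R) :
  continuous f -> measurable_fun setT (f : borel T -> R).
Proof.
move=> /continuousP cf.
apply: (@measurability _ _ (borel T) (measurableTypeR R) setT f _
  (RGenOInfty.measurableE R)).
move=> _ [_ [x ->] <-]; rewrite setTI.
apply: open_borel; apply: cf; exact: interval_open.
Qed.

End borel_measurability.

Section metric_topology.
Variables (R : realType) (X : metricType R).

Lemma open_mdist_lt (x : X) (r : R) : open [set y | (mdist x y < r)%R].
Proof.
rewrite openE => y /= xy; apply/nbhs_ballP.
exists (r - mdist x y)%R; first by rewrite /= subr_gt0.
move=> z /=; rewrite ballEmdist /= ltrBrDl.
exact/le_lt_trans/metric_triangle.
Qed.

Lemma continuous_mdist (x : X) : continuous (fun y : X => mdist x y).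
Proof.
move=> y; apply/cvgrPdist_lt => e e0; near=> z.
have : (mdist y z < e)%R.
  near: z; apply/nbhs_ballP; exists e => // z; by rewrite ballEmdist.
have := metric_triangle x y z; have := metric_triangle x z y.
rewrite (metric_sym z y) ltr_norml; lra.
Unshelve. all: by end_near. Qed.

Lemma closed_mdist_le (x : X) (r : R) : closed [set y | (mdist x y <= r)%R].
Proof.
apply: (@preimage_closed _ _ (fun y => mdist x y) [set z : R | (z <= r)%R]).
  by move=> y _; exact: continuous_mdist.
exact: closed_le.
Qed.

End metric_topology.

Section geodesic_measurability.
Variables (R : realType) (X : completeMetricType R).

Lemma continuous_geo_eval (t : {i01 R}) : continuous (@geo_eval R X t).
Proof.
move=> g; apply: (@continuous_comp _ _ _ set_val
  (fun h : {uniform {i01 R} -> X} => h t)).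
  exact: initial_continuous.
move=> B; rewrite /= -nbhs_entourageE => -[E entE EB].
apply/uniform_nbhs; exists E; split => // h /= hE; apply: EB.
by rewrite /xsection /= inE; exact: hE.
Qed.

Lemma measurable_geo_eval (t : {i01 R}) (A : set (borel X)) : measurable A ->
  measurable (geo_eval t @^-1` A : set (borel (Geo X))).
Proof.
by move=> mA; have := continuous_borel (@continuous_geo_eval t) measurableT mA;
  rewrite setTI.
Qed.

End geodesic_measurability.

(** * Inner regularity by closed bounded sets *)

Lemma nonincreasing_measure_lt d (T : measurableType d) (R : realType)
    (mu : {measure set T -> \bar R}) (F : (set T)^nat) (e : \bar R) :
  mu setT < +oo -> (forall i, measurable (F i)) ->
  {homo F : n m / (n <= m)%N >-> (m <= n)%O} ->
  mu (\bigcap_n F n) < e -> exists n, mu (F n) < e.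
Proof.
move=> fin mF ndF Fe.
have F0 : mu (F 0%N) < +oo.
  by apply: le_lt_trans fin; apply: le_measure; rewrite ?inE.
have := nonincreasing_cvg_mu F0 mF (bigcapT_measurable mF) ndF.
move=> /(_ [set x | x < e]) /= [|N _ NF].
  by apply: open_nbhs_nbhs; split => //; exact: open_ereal_lt_ereal.
by exists N; exact: (NF N (leqnn N)).
Qed.

Lemma nonincreasing_setD_bigcup T (U : set T) (F : (set T)^nat) :
  {homo (fun n => U `\` \bigcup_(i < n) F i) : n m / (n <= m)%N >-> (m <= n)%O}.
Proof.
move=> n m nm; apply/subsetPset; apply: setDS => x [i /= ik Fx].
by exists i => //=; exact: leq_trans ik nm.
Qed.

Section closed_regularity.
Variables (R : realType) (X : completeMetricType R).

(** Good-sets argument: the sets that can be so approximated form a sigma-algebra containing the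
    open sets. Finite mass gives continuity from above. *)
Lemma closed_regularity (mu : {measure set (borel X) -> \bar R}) :
  mu setT < +oo -> forall A : set (borel X), measurable A ->
  forall e : R, (0 < e)%R -> exists F U : set X,
    [/\ closed F, open U, F `<=` A, A `<=` U & mu (U `\` F) < e%:E].
Proof.
move=> fin; apply: smallest_sub => [|U oU e e0].
  split.
  - move=> e e0; exists set0, set0; split=> //; [exact: closed0|exact: open0|].
    by rewrite setD0 measure0 lte_fin.
  - move=> A hA e e0; have [F [U [cF oU FA AU ?]]] := hA e e0.
    exists (~` U), (~` F); split; [exact: open_closedC|exact: closed_openC|..].
    + by rewrite setTD; exact: subsetC.
    + by rewrite setTD; exact: subsetC.
    + by rewrite setDE setCK setIC -setDE.
  move=> A hA e e0.
  (* These errors sum to [e / 2], strictly below [e], which leaves room for the truncation below. *)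
  have en0 n : (0 < e / 2 / (2 ^ n.+1)%:R)%R.
    by rewrite !divr_gt0// ltr0n expn_gt0.
  have /choice[F /choice[U FU]] : forall n, exists F U : set X,
      [/\ closed F, open U, F `<=` A n, A n `<=` U &
          mu (U `\` F) < (e / 2 / (2 ^ n.+1)%:R)%:E].
    by move=> n; exact: (hA n _ (en0 n)).
  have oU n : open (U n) by case: (FU n).
  have cF n : closed (F n) by case: (FU n).
  have mF n : measurable (F n : set (borel X)) by exact: closed_borel.
  have mU n : measurable (U n : set (borel X)) by exact: open_borel.
  (* The union of all [F i] may fail to be closed, so it is cut at a finite index, found by
     continuity from above along the decreasing sets [D n]. *)
  pose V := \bigcup_n U n; pose D n := V `\` \bigcup_(i < n) F i.
  have mV : measurable (V : set (borel X)) by exact: bigcupT_measurable.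
  have mD n : measurable (D n : set (borel X)).
    by apply: measurableD => //; exact: bigcup_measurable.
  have DE : \bigcap_n D n = V `\` \bigcup_n F n.
    apply/seteqP; split=> [x Dx|x [Vx nFx] n _].
      split; first by have [] := Dx 0%N I.
      by move=> [n _ Fnx]; have [_] := Dx n.+1 I; apply; exists n => /=.
    by split => // -[i _ Fix]; apply: nFx; exists i.
  have [n Dn] : exists n, mu (D n) < e%:E.
    apply: nonincreasing_measure_lt => //.
      exact: nonincreasing_setD_bigcup.
    rewrite DE; apply: (@le_lt_trans _ _ (e / 2)%:E); last first.
      by rewrite lte_fin ltr_pdivrMr// ltr_pMr// ltr1n.
    have e20 : (0 <= e / 2)%R by rewrite divr_ge0// ltW.
    have := @epsilon_trick R (fun=> 0) (e / 2)%R xpredT (fun=> lexx _) e20.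
    rewrite [X in _ <= X + _]eseries0// add0e; apply: le_trans.
    apply: (@le_trans _ _ (\sum_(0 <= i <oo) mu (U i `\` F i))).
      apply: measure_sigma_subadditive.
      + by move=> n; exact: measurableD.
      + by apply: measurableD => //; exact: bigcupT_measurable.
      + move=> x [[i _ Uix] nFx]; exists i => //; split => // Fix.
        by apply: nFx; exists i.
    apply: lee_nneseries => i _ //.
    by rewrite [leRHS]add0e ltW//; case: (FU i).
  exists (\bigcup_(i < n) F i), V; split => //.
  - by apply: closed_bigcup => //; exact: finite_II.
  - exact: bigcup_open.
  - by move=> x [i _ Fix]; exists i => //; case: (FU i) => _ _ + _ _; exact.
  - by move=> x [i _ Aix]; exists i => //; case: (FU i) => _ _ _ + _; exact.
(* For open [U], [F n] consists of the points at distance at least 1/(n+1) from every point of the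
   complement; these closed sets exhaust [U]. *)
pose F n := ~` \bigcup_(y in ~` U) [set z | (mdist y z < n.+1%:R^-1)%R].
have cF n : closed (F n).
  by apply: open_closedC; apply: bigcup_open => y _; exact: open_mdist_lt.
have FU n : F n `<=` U.
  move=> x; apply: contra_notP => nUx; exists x => //=.
  by rewrite mdistxx invr_gt0.
have mUF n : measurable (U `\` F n : set (borel X)).
  by apply: measurableD; [exact: open_borel|exact: closed_borel].
have UF0 : \bigcap_n (U `\` F n) = set0.
  rewrite -subset0 => x xUF.
  have Ux : U x by have [] := xUF 0%N I.
  have /nbhs_ballP[r /= r0 rU] : nbhs x U by exact: open_nbhs_nbhs.
  have [n nr] : exists n, (n.+1%:R^-1 < r)%R.
    exists (Num.truncn r^-1); rewrite invf_plt ?posrE//; exact: truncnS_gt.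
  have [_] := xUF n I; apply => -[y nUy /= yx]; apply/nUy/rU.
  by rewrite ballEmdist /= metric_sym; exact: lt_trans nr.
have [n nUF] : exists n, mu (U `\` F n) < e%:E.
  apply: nonincreasing_measure_lt => //; last first.
    by rewrite UF0 measure0 lte_fin.
  move=> n m nm; apply/subsetPset; apply: setDS; apply: subsetC.
  move=> x [y nUy /= yx].
  exists y => //=; apply: lt_le_trans yx _.
  by rewrite lef_pV2 ?posrE// ler_nat.
by exists (F n), U; split.
Qed.

(** [A] is first cut by a large ball about the base point; the restriction of [m] to that ball is
    finite, so [closed_regularity] applies to it. *)
Lemma closed_inner_regularity (m : {measure set (borel X) -> \bar R}) :
  (forall A : set (borel X), measurable A -> metric_bounded A -> m A < +oo) ->
  forall (A : set (borel X)) (a : \bar R), measurable A -> a < m A ->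
  exists F : set X, [/\ closed F, metric_bounded F, F `<=` A & a < m F].
Proof.
move=> fin A a mA aA; pose x0 : X := point.
pose B n : set (borel X) := [set y | (mdist x0 y <= n%:R)%R].
have mB n : measurable (B n) by apply: closed_borel; exact: closed_mdist_le.
have bB n : metric_bounded (B n) by exists x0, n%:R.
have AB : \bigcup_n (A `&` B n) = A.
  apply/seteqP; split=> [x [? _ []]//|x Ax].
  exists (Num.truncn (mdist x0 x)).+1 => //; split => //.
  by rewrite /B /= ltW// truncnS_gt.
have mAB n : measurable (A `&` B n) by exact: measurableI.
have [n aABn] : exists n, a < m (A `&` B n).
  have ndAB : nondecreasing_seq (fun n => A `&` B n).
    move=> i j ij; apply/subsetPset; apply: setIS => x /= /le_trans; apply.
    by rewrite ler_nat.
  have := @nondecreasing_cvg_mu _ _ _ m _ mAB (bigcupT_measurable _ mAB) ndAB.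
  rewrite AB => /(_ [set x | a < x]) /= [|N _ NF].
    by apply: open_nbhs_nbhs; split => //; exact: open_ereal_gt_ereal.
  by exists N; exact: (NF N (leqnn N)).
have fB : m (B n) < +oo by exact: fin.
have fAB : m (A `&` B n) < +oo.
  by apply: le_lt_trans fB; apply: le_measure; rewrite ?inE.
(* [e] is the mass that may be lost while staying above [a]: half of the gap, or anything if
   [a = -oo]. *)
have [e e0 eAB] : exists2 e : R, (0 < e)%R & a + e%:E < m (A `&` B n).
  have fABn : m (A `&` B n) \is a fin_num by rewrite ge0_fin_numE.
  case: a aABn {aA} => [a| |].
  - move=> aAB; exists ((fine (m (A `&` B n)) - a) / 2)%R.
      by rewrite divr_gt0// subr_gt0 -lte_fin fineK.
    by move: aAB; rewrite -(fineK fABn) -EFinD !lte_fin; lra.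
  - by rewrite ltNge leey.
  - by move=> _; exists 1%R => //; rewrite ltNye_eq fABn.
have restr_fin : mrestr m (mB n) setT < +oo by rewrite /mrestr setTI.
have [F [U [cF oU FA AU UF]]] := closed_regularity restr_fin (mAB n) e0.
exists F; split => //; last 1 first.
- have mF : measurable (F : set (borel X)) by exact: closed_borel.
  have : m (A `&` B n) <= m F + e%:E.
    apply: (@le_trans _ _ (m F + m ((U `\` F) `&` B n))).
      apply: (@le_trans _ _ (m (F `|` ((U `\` F) `&` B n)))).
        apply: le_measure; rewrite ?inE//.
          apply: measurableU => //; apply: measurableI => //.
          by apply: measurableD => //; exact: open_borel.
        move=> x ABx; have [Fx|nFx] := pselect (F x); [by left|right].
        by split; [split => //; exact: AU|case: ABx].
      apply: measureU2 => //; apply: measurableI => //.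
      by apply: measurableD => //; exact: open_borel.
    by rewrite leeD2l// ltW.
  move=> /(lt_le_trans eAB).
  by rewrite lteD2rE.
- by exists x0, n%:R => y /FA[].
- by move=> x /FA[].
Qed.

End closed_regularity.

(** * The support has full measure, and the completion is tested on measurable supersets *)

Section support_and_completion.
Variables (R : realType) (X : completeMetricType R).
Variable m : {measure set (borel X) -> \bar R}.

(** Lindelof argument: a point off the support has a null open neighbourhood, hence lies in a null
    ball of radius 1/(k+1) about a point of a countable dense set, and there are countably many such
    balls. *)
Lemma negligible_setC_msupport : separable X -> m.-negligible (~` msupport m).
Proof.
move=> [D cD dD].
have [f fD] : exists f : nat -> X, D `<=` range f.
  have [D0|[f]] := pfcard_geP cD; last by exists f; have := @surj _ _ _ _ f.
  have [x []] := dD setT (ex_intro _ point I) openT.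
  by rewrite D0.
pose V (p : nat * nat) := [set y | (mdist (f p.1) y < p.2.+1%:R^-1)%R].
pose W k := if unpickle k is Some p then
  if m (V p) == 0 then V p else set0 else set0.
have negW k : m.-negligible (W k).
  rewrite /W; case: unpickle => [p|]; last exact: negligible_set0.
  case: eqP => [mV|_]; last exact: negligible_set0.
  apply/negligibleP => //; apply: open_borel; exact: open_mdist_lt.
apply: negligibleS (negligible_bigcup negW) => x.
move=> /existsNP[U /not_implyP[oU /not_implyP[Ux /negP]]].
rewrite -leNgt => mU0.
have /nbhs_ballP[r /= r0 rU] : nbhs x U by exact: open_nbhs_nbhs.
(* With radius below [r / 2], a ball whose centre is this close to [x] stays within distance [r] of
   [x], hence inside [U]. *)
have [k kr] : exists k, (k.+1%:R^-1 < r / 2)%R.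
  exists (Num.truncn (r / 2)^-1); rewrite invf_plt ?posrE ?divr_gt0//.
  exact: truncnS_gt.
have [y [/= xy /fD[i _ fiy]]] : [set y | (mdist x y < k.+1%:R^-1)%R] `&` D !=set0.
  apply: dD; last exact: open_mdist_lt.
  by exists x; rewrite /= mdistxx invr_gt0.
have Vx : V (i, k) x by rewrite /V /= fiy metric_sym.
have VU : V (i, k) `<=` U.
  move=> z; rewrite /V /= fiy => yz; apply: rU; rewrite ballEmdist /=.
  apply: le_lt_trans (metric_triangle x y z) _.
  rewrite [ltRHS]splitr; apply: ltrD; exact: lt_trans kr.
exists (pickle (i, k)) => //; rewrite /W pickleK.
suff -> : m (V (i, k)) == 0 by [].
rewrite eq_le measure_ge0 andbT; apply: le_trans mU0.
apply: le_measure => //; rewrite inE; apply: open_borel => //.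
exact: open_mdist_lt.
Qed.

(** The completion is an infimum over countable measurable covers, and the union of a cover is a
    measurable superset of mass at most the total of the cover. *)
Lemma completion_ge (A : set X) (a : \bar R) :
  (forall B : set (borel X), measurable B -> A `<=` B -> a <= m B) ->
  a <= completion m A.
Proof.
move=> aB; apply: le_ereal_inf_tmp => _ [F [mF AF] <-].
apply: le_trans (aB _ (bigcupT_measurable _ mF) AF) _.
by apply: measure_sigma_subadditive => //; exact: bigcupT_measurable.
Qed.

End support_and_completion.

(** * Entropy of normalized restrictions, and Jensen's inequality *)

Section uniform_probability.
Variables (R : realType) (X : completeMetricType R).
Variable m : {measure set (borel X) -> \bar R}.

Lemma uniform_probability_exists (F : set (borel X)) :
  measurable F -> 0 < m F < +oo ->
  exists mu : probability (borel X) R,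
    forall A, mu A = m (A `&` F) * (fine (m F))^-1%:E.
Proof.
move=> mF /andP[F0 Foo].
have mFT : (mrestr m mF : {measure set (borel X) -> \bar R}) setT = m F.
  by rewrite /= /mrestr setTI.
exists (mnormalize (mrestr m mF) (dirac (point : borel X))) => A.
suff : mnormalize (mrestr m mF) (dirac (point : borel X)) A =
    m (A `&` F) * (fine (m F))^-1%:E by [].
by rewrite /mnormalize mFT gt_eqF//= lt_eqF.
Qed.

Variables (F : set (borel X)) (b : R) (mu : probability (borel X) R).
Hypotheses (cF : closed (F : set X)) (bF : metric_bounded F).
Hypotheses (b0 : (0 < b)%R) (mFb : m F = b%:E).
Hypothesis muE : forall A, mu A = m (A `&` F) * b^-1%:E.

Let mF : measurable F. Proof. exact: closed_borel. Qed.

Lemma uniform_negligible (A : set (borel X)) :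
  measurable A -> m A = 0 -> mu A = 0.
Proof.
move=> mA A0; rewrite muE (_ : m _ = 0) ?mul0e//.
apply/eqP; rewrite eq_le measure_ge0 andbT -A0.
by apply: le_measure; rewrite ?inE//; exact: measurableI.
Qed.

Lemma uniform_setC0 : mu (~` F) = 0.
Proof. by rewrite muE setICl measure0 mul0e. Qed.

Lemma uniform_msupport : msupport mu `<=` F.
Proof.
move=> x xmu; apply: contrapT => nFx.
by have := xmu _ (closed_openC cF) nFx; rewrite uniform_setC0 ltxx.
Qed.

Lemma uniform_Pbs : Pbs m mu.
Proof.
split; first by have [x [r h]] := bF; exists x, r => y /uniform_msupport /h.
move=> x xmu U oU Ux; rewrite lt_neqAle measure_ge0 andbT eq_sym.
apply/eqP => U0; have := xmu _ oU Ux.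
by rewrite uniform_negligible ?ltxx//; exact: open_borel.
Qed.

Lemma uniform_finite_second_moment : finite_second_moment mu.
Proof.
have [x0 [r h]] := bF; exists x0.
apply: (@le_lt_trans _ _ (\int[mu]_x (cst (r ^+ 2)%:E x))); last first.
  by rewrite integral_cst// [X in _ * X]probability_setT mule1 ltry.
apply: ae_ge0_le_integral => //.
- by move=> x _; rewrite lee_fin sqr_ge0.
- apply/measurable_EFinP; apply: measurable_funX.
  apply: continuous_borel_real; exact: continuous_mdist.
- by move=> x _; rewrite lee_fin sqr_ge0.
- exists (~` F); split; [exact: measurableC|exact: uniform_setC0|].
  move=> x /= nh Fx; apply: nh => _; rewrite lee_fin lerXn2r ?nnegrE ?mdist_ge0//.
    by apply: le_trans (h _ Fx); exact: mdist_ge0.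
  exact: h.
Qed.

Let rho (x : borel X) : R := (\1_F x * b^-1)%R.

Let mul_ln_rho x : (rho x * ln (rho x) = (b^-1 * ln b^-1) * \1_F x)%R.
Proof.
by rewrite /rho indicE; case: (_ \in _); rewrite ?mul1r ?mulr1// !mul0r mulr0.
Qed.

Let mrho : measurable_fun setT rho.
Proof. exact: measurable_funM. Qed.

Let integrable_indic c : m.-integrable setT (fun x => (c * \1_F x)%:E).
Proof.
rewrite (_ : (fun _ => _) = (fun x => c%:E * (\1_F x)%:E)); last first.
  by apply/funext => x; rewrite EFinM.
apply: integrableZl => //; apply/integrableP; split.
  by apply/measurable_EFinP.
rewrite (eq_integral (fun x => (\1_F x)%:E)); last first.
  by move=> x _; rewrite gee0_abs.
by rewrite integral_indic// setIT mFb ltry.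
Qed.

Let rho_density : entropy_density m mu rho.
Proof.
split => //.
- by move=> x; rewrite /rho mulr_ge0// invr_ge0 ltW.
- move=> A mA; rewrite muE muleC; under eq_integral do rewrite /rho mulrC EFinM.
  rewrite ge0_integralZl//.
  + by rewrite integral_indic// setIC.
  + by apply/measurable_EFinP.
  + by rewrite lee_fin invr_ge0 ltW.
- under eq_fun do rewrite mul_ln_rho; exact: integrable_indic.
Qed.

(** [Ent] uses an unspecified density; almost everywhere uniqueness replaces it by the explicit
    [rho], for which the integrand is the constant [b^-1 * ln b^-1] on [F], a set of mass [b]. *)
Lemma Ent_uniform : Ent m mu = (- ln b)%:E.
Proof.
rewrite /Ent; case: pselect => [h|]; last first.
  move=> h; exfalso; apply: h; exists rho; split => //.
  exact: uniform_finite_second_moment.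
case: cid => rho' /= [_ [mrho' rho'0 rho'E _]].
have rr' : ae_eq m setT (EFin \o rho) (EFin \o rho').
  apply: integral_ae_eq => //.
  - rewrite (_ : _ \o _ = (fun x => (b^-1 * \1_F x)%:E)) ?integrable_indic//.
    by apply/funext => x; rewrite /= /rho mulrC.
  - exact/measurable_EFinP.
  - move=> E _ mE; case: rho_density => _ _ + _ => /(_ _ mE) <-.
    exact: rho'E.
rewrite (@ae_eq_integral _ _ _ m setT (fun x => (rho x * ln (rho x))%:E)) //.
- under eq_integral do rewrite mul_ln_rho EFinM.
  rewrite integralZl//; last first.
    rewrite (_ : (fun _ => _) = (fun x => (1 * \1_F x)%:E)) ?integrable_indic//.
    by apply/funext => x; rewrite mul1r.
  rewrite integral_indic// setIT mFb -EFinM lnV ?posrE//.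
  by congr _%:E; rewrite mulrN mulNr mulrAC mulVf ?mul1r// gt_eqF.
- apply/measurable_EFinP; apply: measurable_funM => //.
  by apply: measurableT_comp => //; exact: measurable_ln.
- apply/measurable_EFinP; apply: measurable_funM => //.
  by apply: measurableT_comp => //; exact: measurable_ln.
- by apply: filterS rr' => x /= xr /xr [->].
Qed.

Lemma Un_uniform (n : R) : (0 < n)%R -> Un m n mu = m F `^ n^-1.
Proof.
move=> n0; rewrite /Un Ent_uniform mFb /= /powR gt_eqF//.
by rewrite mulrN opprK.
Qed.

End uniform_probability.

(* Jensen, by integrating over [B] the tangent line of [x * ln x] at [1 / m B]. *)
Lemma Un_le_measure (R : realType) (X : completeMetricType R)
    (m : {measure set (borel X) -> \bar R}) (n : R) (B : set (borel X))
    (mu : set (borel X) -> \bar R) :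
  (0 < n)%R -> measurable B -> mu B = 1 -> mu (~` B) = 0 ->
  Un m n mu <= m B `^ n^-1.
Proof.
move=> n0 mB muB muBC; rewrite /Un /Ent; case: pselect => [h|_]; last first.
  by rewrite gt0_muley ?lte_fin ?invr_gt0//= poweR_ge0.
case: cid => rho /= [_ [mrho rho0 rhoE irho]].
have [->|Boo] := eqVneq (m B) +oo.
  by rewrite poweRyr ?leey// invr_neq0 ?gt_eqF.
have mBfin : m B \is a fin_num by rewrite ge0_fin_numE// ltey.
have mB0 : m B != 0.
  apply/eqP => mB0; have := rhoE _ mB; rewrite muB null_set_integral//.
    by move/eqP; rewrite onee_eq0.
  by apply: measurable_funTS; apply/measurable_EFinP.
set b := fine (m B); have mBb : m B = b%:E by rewrite fineK.
have b0 : (0 < b)%R by rewrite -lte_fin -mBb lt_neqAle eq_sym mB0 measure_ge0.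
suff key : (- ln b)%:E <= \int[m]_x (rho x * ln (rho x))%:E.
  rewrite mBb /poweR /powR gt_eqF//.
  rewrite -[leRHS]/(expeR (n^-1 * ln b)%:E) lee_expeR leeNl.
  have -> : - (n^-1 * ln b)%:E = n^-1%:E * (- ln b)%:E by rewrite -EFinM mulrN.
  by rewrite lee_pmul2l// lte_fin invr_gt0.
have mrhoE D : measurable_fun D (EFin \o rho).
  by apply: measurable_funTS; apply/measurable_EFinP.
(* Since [mu] gives no mass to the complement of [B], [rho] vanishes almost everywhere there, and so
   does the integrand. *)
have -> : \int[m]_x (rho x * ln (rho x))%:E =
    \int[m]_(x in B) (rho x * ln (rho x))%:E.
  rewrite -(setUv B) integral_setU//; last 3 first.
  - exact: measurableC.
  - by rewrite setUv; exact: measurable_int irho.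
  - by apply/disj_setPS; rewrite setICr.
  rewrite [X in _ + X](_ : _ = 0) ?adde0//.
  rewrite (@ae_eq_integral _ _ _ m _ (cst 0)) ?integral0//.
  - exact: measurableC.
  - by apply: measurable_funTS; exact: measurable_int irho.
  - have : \int[m]_(x in ~` B) `|(EFin \o rho) x| = 0.
      rewrite -muBC rhoE; last exact: measurableC.
      by apply: eq_integral => x _; rewrite gee0_abs// lee_fin.
    move/(ae_eq_integral_abs m (measurableC mB) (mrhoE _)).1.
    by apply: filterS => x /= xr /xr [->]; rewrite mul0r.
have irhoB : m.-integrable B (EFin \o rho).
  apply/integrableP; split => //.
  rewrite (eq_integral (EFin \o rho)) -?rhoE ?muB ?ltry// => x _.
  by rewrite gee0_abs// lee_fin.
have iB c : m.-integrable B (fun=> c%:E).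
  apply/integrableP; split => //.
  by rewrite (eq_integral (cst `|c|%:E)) ?integral_cst// ?mBb -?EFinM ?ltry//.
(* [c] is the slope of the tangent at [b^-1]. As [rho] has integral 1 over [B], the tangent line
   integrates to [c - 1 = - ln b]. *)
pose c := (ln b^-1 + 1)%R.
have iBc : m.-integrable B (fun x => c%:E * (EFin \o rho) x).
  exact: integrableZl.
have -> : (- ln b)%:E = \int[m]_(x in B) (c%:E * (EFin \o rho) x - b^-1%:E).
  rewrite integralB// integralZl// -rhoE// muB mule1 integral_cst// mBb -EFinM.
  by rewrite mulVf ?gt_eqF// -EFinB /c addrK lnV.
apply: le_integral => //.
- exact: integrableB.
- exact: integrableS irho.
- move=> x _; rewrite /= -EFinM -EFinB lee_fin mulrC mul_ln_ge_tangent//.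
  by rewrite invr_gt0.
Qed.

(** * Nonnegativity of distortion coefficients *)

Section distortion_sign.
Variables (R : realType) (s : R -> R) (N : R).
Hypothesis hs : distortion_datum s N.

(** Near 0 the remainder is at most half of the leading term, so at least half of that positive term
    survives. *)
Lemma distortion_datum_gt0_near :
  exists2 d : R, (0 < d)%R & forall th : R, (0 < th < d)%R -> (0 < s th)%R.
Proof.
have [_ _ [c c0 /eqaddoP/= sc]] := hs.
have c20 : (0 < c / 2)%R by rewrite divr_gt0.
have [d /= d0 sd] := sc _ c20.
exists d => // th /andP[th0 thd].
have := sd th; rewrite /= sub0r normrN gtr0_norm// => /(_ thd th0).
have := powR_gt0 N th0; set p := (th `^ N)%R => p0.
rewrite (gtr0_norm p0) ler_norml !fctE => /andP[+ _].
have : (0 < c / 2 * p)%R by rewrite mulr_gt0.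
by rewrite /p; lra.
Qed.

Lemma first_zero_gt0 : 0 < first_zero s.
Proof.
have [d d0 sd] := distortion_datum_gt0_near.
apply: (@lt_le_trans _ _ d%:E); first by rewrite lte_fin.
apply: le_ereal_inf_tmp => _ [th [th0 sth] <-].
rewrite lee_fin leNgt; apply/negP => thd.
by have := sd th; rewrite th0 thd sth ltxx => /(_ isT).
Qed.

(** As [s] is positive near 0, a nonpositive value at [th] would produce, by the intermediate value
    theorem, a zero no later than [th]. *)
Lemma lt_first_zero_gt0 (th : R) :
  (0 < th)%R -> th%:E < first_zero s -> (0 < s th)%R.
Proof.
move=> th0 thD; rewrite ltNge; apply/negP => sth.
have [d d0 sd] := distortion_datum_gt0_near.
have [_ cs _] := hs.
pose a := (Num.min d th / 2)%R.
have m0 : (0 < Num.min d th)%R by rewrite lt_min d0.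
have a0 : (0 < a)%R by rewrite divr_gt0.
have am : (a < Num.min d th)%R by rewrite /a; lra.
have [ad ath] : (a < d)%R /\ (a < th)%R by move: am; rewrite lt_min => /andP.
have sa : (0 < s a)%R by apply: sd; rewrite a0.
have [||c] := @IVT _ s a th 0%R (ltW ath).
- apply: continuous_subspaceW cs => x /=; rewrite !in_itv /= => /andP[ax _].
  by rewrite andbT (le_trans (ltW a0)).
- by rewrite ge_min le_max sth (ltW sa) orbT.
rewrite in_itv/= => /andP[ac cth] sc.
move: thD; rewrite ltNge => /negP; apply.
apply: (@le_trans _ _ c%:E); last by rewrite lee_fin.
by apply: ereal_inf_lbound; exists c => //; split => //; exact: lt_le_trans ac.
Qed.

Lemma distortion_ge0 (t : R) (th : \bar R) :
  (0 < t < 1)%R -> 0 <= th -> 0 <= distortion s N t th.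
Proof.
move=> /andP[t0 t1] th0; rewrite /distortion.
have ratio_ge0 (phi : \bar R) : 0 < phi -> phi < first_zero s ->
    0 <= (s (t * fine phi) / s (fine phi))%:E.
  case: phi => [x| |]//; last by move=> _; rewrite ltNge leey.
  rewrite lte_fin => x0 xD; rewrite lee_fin divr_ge0//.
    apply/ltW/lt_first_zero_gt0; first by rewrite mulr_gt0.
    by apply: lt_trans xD; rewrite lte_fin /= gtr_pMl.
  exact/ltW/lt_first_zero_gt0.
have [//|thN0] := eqVneq; first by rewrite lee_fin powR_ge0.
case: ifPn => [thD|_]; first by rewrite ratio_ge0// lt_neqAle eq_sym thN0.
(* The lower limit is a supremum of infima over the sets of the filter; the set of [phi] strictly
   between 0 and the first zero is one of them, and the ratio is nonnegative on it. *)
rewrite limf_einfE; apply: le_trans; last first.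
  apply: ereal_sup_ubound.
  exists [set phi | 0 < phi /\ phi < first_zero s] => //.
  have := conj (@open_ereal_gt_ereal R 0) first_zero_gt0.
  move=> /open_nbhs_nbhs; apply: filterS.
  by move=> phi /= phi0 phiD.
by apply: le_ereal_inf_tmp => _ [phi [phi0 phiD] <-]; exact: ratio_ge0.
Qed.

End distortion_sign.

(** * Almost sure events, and mass as a supremum over closed bounded sets *)

Section probability_one.
Context d (T : measurableType d) (R : realType) (P : probability T R).

Lemma probability_setC_eq0 (A : set T) : measurable A -> P (~` A) = 0 -> P A = 1.
Proof.
move=> mA PA; rewrite -[A]setCK probability_setC ?PA ?sube0//.
exact: measurableC.
Qed.

Lemma probability_setC_eq0P (A : set T) : measurable A -> P A = 1 -> P (~` A) = 0.
Proof. by move=> mA PA; rewrite probability_setC// PA subee. Qed.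

Lemma probability_setI_eq1 (A B : set T) :
  measurable A -> measurable B -> P A = 1 -> P B = 1 -> P (A `&` B) = 1.
Proof.
move=> mA mB PA PB; apply: probability_setC_eq0; first exact: measurableI.
rewrite setCI; apply/eqP; rewrite eq_le measure_ge0 andbT.
apply: le_trans (measureU2 _ (measurableC mA) (measurableC mB)) _.
by rewrite [X in X + _](probability_setC_eq0P mA PA)
  [X in _ + X](probability_setC_eq0P mB PB) adde0.
Qed.

Lemma probability_subset_eq1 (A B : set T) :
  measurable A -> measurable B -> A `<=` B -> P A = 1 -> P B = 1.
Proof.
move=> mA mB AB PA; apply/eqP; rewrite eq_le probability_le1//= -PA.
by apply: le_measure; rewrite ?inE.
Qed.

End probability_one.

Section closed_inner_sup.
Variables (R : realType) (X : completeMetricType R).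
Variable m : {measure set (borel X) -> \bar R}.
Hypothesis hX : metric_measure_space m.

(** Positive mass, with the finiteness that comes from boundedness, is what normalizing [m] on [F]
    requires. *)
Definition closed_bounded_pos (A : set X) : set (set X) :=
  [set F | [/\ closed F, metric_bounded F, F `<=` A & 0 < m F]].

Lemma closed_bounded_pos_nonempty (A : set (borel X)) :
  measurable A -> 0 < m A -> closed_bounded_pos A !=set0.
Proof.
move=> mA A0; have [F []] := closed_inner_regularity hX.2 mA A0.
by exists F.
Qed.

Lemma measure_closed_sup (A : set (borel X)) : measurable A -> 0 < m A ->
  m A = ereal_sup [set m F | F in closed_bounded_pos A].
Proof.
move=> mA A0; apply/eqP; rewrite eq_le; apply/andP; split; last first.
  apply: ge_ereal_sup => _ [F [cF _ FA _] <-].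
  by apply: le_measure; rewrite ?inE//; exact: closed_borel.
rewrite leNgt; apply/negP => supA.
(* The maximum with 0 ensures that the set found has positive mass, hence belongs to the family. *)
have mx : Order.max 0 (ereal_sup [set m F | F in closed_bounded_pos A]) < m A.
  by rewrite gt_max A0.
have [F [cF bF FA]] := closed_inner_regularity hX.2 mA mx.
rewrite gt_max => /andP[F0]; rewrite ltNge => /negP; apply.
by apply: ereal_sup_ubound; exists F.
Qed.

End closed_inner_sup.

(** * The inequality for disjoint closed bounded sets *)

Section brunn_minkowski.
Variables (R : realType) (X : completeMetricType R).
Variable m : {measure set (borel X) -> \bar R}.
Variables (G : X -> X -> \bar R) (beta : R -> \bar R -> \bar R) (n : R).
Hypotheses (hX : metric_measure_space m) (hn : (1 <= n)%R).
Variable t : {i01 R}.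
Hypothesis ht : (0 < t%:num < 1)%R.

Definition inf_distortion (b : \bar R -> \bar R) (B0 B1 : set X) : \bar R :=
  ereal_inf [set b (G x.1 x.2) | x in
    (B0 `&` msupport m) `*` (B1 `&` msupport m)].

(** Two pairs of subsets, [B0], [B1] and [C0], [C1], appear because the two set distortions are
    suprema over independent choices of full subsets. *)
Lemma brunn_minkowski_closed_bounded (F0 F1 B0 B1 C0 C1 : set X)
    (B : set (borel X)) : CD m G beta n ->
  closed_bounded_pos m F0 F0 -> closed_bounded_pos m F1 F1 ->
  F0 `&` F1 = set0 ->
  m.-negligible (F0 `\` B0 : set (borel X)) ->
  m.-negligible (F1 `\` B1 : set (borel X)) ->
  m.-negligible (F0 `\` C0 : set (borel X)) ->
  m.-negligible (F1 `\` C1 : set (borel X)) ->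
  0 <= inf_distortion (beta (1 - t%:num)%R) B1 B0 ->
  0 <= inf_distortion (beta t%:num) C0 C1 ->
  measurable B -> intermediate F0 F1 t `<=` B ->
  inf_distortion (beta (1 - t%:num)%R) B1 B0 `^ n^-1 * m F0 `^ n^-1
  + inf_distortion (beta t%:num) C0 C1 `^ n^-1 * m F1 `^ n^-1 <= m B `^ n^-1.
Proof.
move=> hCD [cF0 bF0 _ F0_gt0] [cF1 bF1 _ F1_gt0] F01 N0 N1 N2 N3.
move=> b_ge0 c_ge0 mB FB.
have n0 : (0 < n)%R by exact: lt_le_trans hn.
have [_ finb] := hX.
have mF0 : measurable (F0 : set (borel X)) by exact: closed_borel.
have mF1 : measurable (F1 : set (borel X)) by exact: closed_borel.
have F0_fin : m F0 \is a fin_num by rewrite ge0_fin_numE// finb.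
have F1_fin : m F1 \is a fin_num by rewrite ge0_fin_numE// finb.
have [|mu0 mu0E] := uniform_probability_exists (m := m) mF0.
  by rewrite F0_gt0 finb.
have [|mu1 mu1E] := uniform_probability_exists (m := m) mF1.
  by rewrite F1_gt0 finb.
have b0 : (0 < fine (m F0))%R by rewrite fine_gt0// F0_gt0 finb.
have b1 : (0 < fine (m F1))%R by rewrite fine_gt0// F1_gt0 finb.
have e0 : m F0 = (fine (m F0))%:E by rewrite fineK.
have e1 : m F1 = (fine (m F1))%:E by rewrite fineK.
have disj : msupport mu0 `&` msupport mu1 = set0.
  rewrite -subset0 -F01 => x [x0 x1]; split.
    exact: (uniform_msupport cF0 mu0E).
  exact: (uniform_msupport cF1 mu1E).
have [|nu [[hnu _] _ /(_ _ ht)]] := hCD mu0 mu1 (uniform_Pbs cF0 bF0 mu0E) _ disj.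
  split; first exact: (uniform_Pbs cF1 bF1 mu1E).
  by rewrite (Ent_uniform cF1 bF1 b1 e1 mu1E) ltry.
rewrite (Un_uniform cF0 bF0 b0 e0 mu0E n0) (Un_uniform cF1 bF1 b1 e1 mu1E n0).
(* One measurable null set absorbs every exceptional endpoint: those outside the prescribed subsets
   and those off the support of [m]. *)
have [Z [mZ mZ0 NZ]] : m.-negligible ((F0 `\` B0 `|` F1 `\` B1) `|`
    (F0 `\` C0 `|` F1 `\` C1) `|` ~` msupport m).
  apply: negligibleU; last exact: negligible_setC_msupport hX.1.
  by apply: negligibleU; exact: negligibleU.
have full0 : mu0 (F0 `&` ~` Z) = 1.
  apply: probability_setI_eq1 => //; first exact: measurableC.
    by apply: probability_setC_eq0 => //; exact: uniform_setC0 mu0E.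
  apply: probability_setC_eq0; first exact: measurableC.
  by rewrite setCK; exact: (uniform_negligible cF0 mu0E).
have full1 : mu1 (F1 `&` ~` Z) = 1.
  apply: probability_setI_eq1 => //; first exact: measurableC.
    by apply: probability_setC_eq0 => //; exact: uniform_setC0 mu1E.
  apply: probability_setC_eq0; first exact: measurableC.
  by rewrite setCK; exact: (uniform_negligible cF1 mu1E).
(* Both events have [nu]-probability 1: the end marginals of [nu] are [mu0] and [mu1], which are
   carried by [F0] and [F1] and do not charge [Z]. *)
pose E0 := source @^-1` (F0 `&` ~` Z) : set (borel (Geo X)).
pose E1 := target @^-1` (F1 `&` ~` Z) : set (borel (Geo X)).
have mFZ0 : measurable (F0 `&` ~` Z : set (borel X)).
  by apply: measurableI => //; exact: measurableC.
have mFZ1 : measurable (F1 `&` ~` Z : set (borel X)).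
  by apply: measurableI => //; exact: measurableC.
have mE0 : measurable E0 by exact: measurable_geo_eval.
have mE1 : measurable E1 by exact: measurable_geo_eval.
have nuE0 : nu E0 = 1 by rewrite -full0 -(hnu _ mFZ0).1.
have nuE1 : nu E1 = 1 by rewrite -full1 -(hnu _ mFZ1).2.
have mE : measurable (E0 `&` E1) by exact: measurableI.
have nuE : nu (E0 `&` E1) = 1 by exact: probability_setI_eq1.
have inB g : (E0 `&` E1) g -> 
    [/\ B0 (source g), B1 (target g), C0 (source g) & C1 (target g)] /\
    (msupport m (source g) /\ msupport m (target g)).
  move=> [[F0g Zg0] [F1g Zg1]]; split; split; apply: contrapT => h.
  - by apply: Zg0; apply: NZ; left; left; left.
  - by apply: Zg1; apply: NZ; left; left; right.
  - by apply: Zg0; apply: NZ; left; right; left.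
  - by apply: Zg1; apply: NZ; left; right; right.
  - by apply: Zg0; apply: NZ; right.
  - by apply: Zg1; apply: NZ; right.
(* The CD inequality [hU] is bracketed: on [E0] and [E1] the distortion is at least the infima, and
   the [t]-marginal is carried by [B]. *)
move=> hU; apply: le_trans (le_trans hU _).
  apply: leeD; (apply: lee_pmul => //; try exact: poweR_ge0).
  - apply: (poweR_le_expeR_integral_lne _ _ mE nuE); rewrite ?invr_gt0//.
    move=> g /inB[[? ? _ _] [? ?]]; apply: ereal_inf_lbound.
    by exists (target g, source g).
  - apply: (poweR_le_expeR_integral_lne _ _ mE nuE); rewrite ?invr_gt0//.
    move=> g /inB[[_ _ ? ?] [? ?]]; apply: ereal_inf_lbound.
    by exists (source g, target g).
have mtB : measurable (geo_eval t @^-1` B : set (borel (Geo X))).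
  exact: measurable_geo_eval.
have nuB : nu (geo_eval t @^-1` B) = 1.
  apply: (probability_subset_eq1 mE mtB _ nuE) => g [[F0g _] [F1g _]].
  by apply: FB; exists g.
apply: Un_le_measure => //.
by rewrite /push_geo /pushforward preimage_setC; exact: probability_setC_eq0P.
Qed.

End brunn_minkowski.

(** * Passage to Borel sets *)

Theorem theorem4p1 (R : realType) (X : completeMetricType R)
    (m : {measure set (borel X) -> \bar R}) (G : X -> X -> \bar R)
    (s : R -> R) (N n : R)
    (hX : metric_measure_space m) (hG : gauge_function G)
    (hs : distortion_datum s N) (hn : (1 <= n)%R)
    (hCD : CD m G (distortion s N) n)
    (A0 A1 : set (borel X)) (mA0 : measurable A0) (mA1 : measurable A1)
    (A0_gt0 : 0 < m A0) (A1_gt0 : 0 < m A1) (A01 : m (A0 `&` A1) = 0)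
    (t : {i01 R}) (ht : (0 < t%:num < 1)%R) :
  set_distortion m G (distortion s N (1 - t%:num)%R) A1 A0 `^ n^-1 * m A0 `^ n^-1
  + set_distortion m G (distortion s N t%:num) A0 A1 `^ n^-1 * m A1 `^ n^-1
  <= completion m (intermediate A0 A1 t) `^ n^-1.
Proof.
have n0 : (0 < n)%R by exact: lt_le_trans hn.
have n'0 : (0 < n^-1)%R by rewrite invr_gt0.
have t'01 : (0 < 1 - t%:num < 1)%R by case/andP: ht => *; apply/andP; lra.
have inf_ge0 (u : R) (B0 B1 : set X) : (0 < u < 1)%R ->
    0 <= inf_distortion m G (distortion s N u) B0 B1.
  move=> u01; apply: le_ereal_inf_tmp => _ [x _ <-].
  exact: distortion_ge0 (hG.1 _ _).
have full_refl (A : set (borel X)) : 0 < m A -> full_subset m A A.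
  move=> A_gt0; split => //; last by rewrite setDv; exact: negligible_set0.
  by apply/set0P/eqP => A_0; move: A_gt0; rewrite A_0 measure0 ltxx.
(* Removing the overlap gives disjoint sets of the same masses, from which the closed sets are
   taken; the set distortions still refer to [A0] and [A1]. *)
pose D0 := A0 `\` A1; pose D1 := A1 `\` A0.
have mD0 : measurable D0 by exact: measurableD.
have mD1 : measurable D1 by exact: measurableD.
have mDE (A B : set (borel X)) : measurable A -> measurable B ->
    m (A `&` B) = 0 -> m A = m (A `\` B).
  by move=> mA mB AB; rewrite (measureDI m mA mB) [X in _ + X]AB adde0.
have A0E : m A0 = m D0 by exact: mDE.
have A1E : m A1 = m D1 by apply: mDE => //; rewrite setIC.
rewrite A0E in A0_gt0 *; rewrite A1E in A1_gt0 *.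
have inS_ge0 A F : [set m F | F in closed_bounded_pos m A] F -> 0 <= F.
  by move=> [? _ <-].
rewrite (measure_closed_sup hX mD0)// (measure_closed_sup hX mD1)//.
have nonempty (A : set (borel X)) : measurable A -> 0 < m A ->
    [set m F | F in closed_bounded_pos m A] !=set0.
  move=> mA /(closed_bounded_pos_nonempty hX mA)[F AF].
  by exists (m F), F.
have sd_nonempty (b : \bar R -> \bar R) (B0 B1 : set (borel X)) :
    0 < m B0 -> 0 < m B1 ->
    [set e | exists C0 C1, [/\ full_subset m B0 C0, full_subset m B1 C1 &
      e = inf_distortion m G b C0 C1]] !=set0.
  move=> B0_gt0 B1_gt0; exists (inf_distortion m G b B0 B1).
  by exists B0, B1; split => //; exact: full_refl.
have ge0 (x y : \bar R) : 0 <= x `^ n^-1 * y `^ n^-1.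
  by rewrite mule_ge0 ?poweR_ge0.
(* The four suprema, two in the distortions and two in the masses, are removed one by one,
   commutativity bringing each into leading position. *)
apply: poweR_ereal_sup_le => //; rewrite ?poweR_ge0//.
- by apply: sd_nonempty; rewrite ?A0E ?A1E.
- by move=> _ [? [? [_ _ ->]]]; exact: inf_ge0.
move=> _ [B1 [B0 [[B1A1 _ NB1] [B0A0 _ NB0] ->]]].
rewrite muleC; apply: poweR_ereal_sup_le => //; rewrite ?poweR_ge0//.
- exact: nonempty.
- exact: inS_ge0.
move=> _ [F0 [cF0 bF0 F0D0 F0_gt0] <-].
rewrite addeC; apply: poweR_ereal_sup_le => //; rewrite ?poweR_ge0//.
- by apply: sd_nonempty; rewrite ?A0E ?A1E.
- by move=> _ [? [? [_ _ ->]]]; exact: inf_ge0.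
move=> _ [C0 [C1 [[C0A0 _ NC0] [C1A1 _ NC1] ->]]].
rewrite muleC; apply: poweR_ereal_sup_le => //; rewrite ?poweR_ge0//.
- exact: nonempty.
- exact: inS_ge0.
move=> _ [F1 [cF1 bF1 F1D1 F1_gt0] <-].
rewrite addeC muleC [X in _ + X]muleC.
have F0A0 : F0 `<=` A0 by move=> x /F0D0[].
have F1A1 : F1 `<=` A1 by move=> x /F1D1[].
(* Moving the exponent to the other side isolates the completion, which can then be replaced by
   [m B]; afterwards the exponent is moved back. *)
rewrite -le_poweR_inv//; last exact: adde_ge0.
apply: completion_ge => B mB AB; rewrite le_poweR_inv//; last exact: adde_ge0.
apply: (brunn_minkowski_closed_bounded hX hn ht hCD) => //.
- by split.
- by split.
- by rewrite -subset0 => x [/F0D0[_ nA1x] /F1A1].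
- by apply: negligibleS NB0; exact: setSD.
- by apply: negligibleS NB1; exact: setSD.
- by apply: negligibleS NC0; exact: setSD.
- by apply: negligibleS NC1; exact: setSD.
- exact: inf_ge0.
- exact: inf_ge0.
- by move=> _ [g [F0g F1g] <-]; apply: AB; exists g => //; split;
    [exact: F0A0|exact: F1A1].
Qed.
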